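(* For any $g\ge 2$ there is $d_0=d_0(g)\ge g$ such that for $d=g,\dots,d_0$, the locus $\mathcal{C}^{(d)}(g-1,g-1)$ contains no surface with a strictly convex presentation.
   Context: A translation surface is a connected closed surface obtained from polygons in $\mathbb{R}^2$ by gluing edges in pairs by translations, up to cut-and-paste equivalence (equivalently, a pair $(X,\omega)$ with $X$ a compact Riemann surface and $\omega\ne0$ a holomorphic 1-form). $\mathcal{H}(g-1,g-1)$ is the stratum of genus $g$ translation surfaces with two singularities, both zeros of $\omega$ of order $g-1$. Its hyperelliptic component consists of those $(X,\omega)$ with $X$ hyperelliptic whose hyperelliptic involution exchanges the two zeros. For $g\ge2$ and $d\ge g$, $\mathcal{C}^{(d)}(g-1,g-1)$ denotes the Hurwitz space of surfaces in the hyperelliptic component of $\mathcal{H}(g-1,g-1)$ which admit a degree $d$ translation cover of a torus branched over two points. A translation surface $M$ has a strictly convex presentation if $M$ is obtained from a single strictly convex polygon $P\subset\mathbb{R}^2$ by identifying its edges in pairs by translations. A polygon is strictly convex if all internal angles at its vertices are strictly less than $\pi$. *)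

(* Defs.v *)
From HB Require Import structures.
From Stdlib Require Import Relation_Operators.
From mathcomp Require Import all_boot all_order all_algebra.
From mathcomp Require Import complex.
From mathcomp Require Import all_classical all_reals all_analysis.

Set Implicit Arguments.
Unset Strict Implicit.
Unset Printing Implicit Defensive.

Import Order.TTheory GRing.Theory Num.Theory.
Import numFieldNormedType.Exports.

Local Open Scope classical_set_scope.
Local Open Scope card_scope.
Local Open Scope complex_scope.
Local Open Scope ring_scope.

(* The plane, identified with the complex numbers. *)
Notation plane R := (R[i]^o).

(* A pair (X, omega): a compact connected Riemann surface X with a nonzero
   holomorphic 1-form omega.  The data attach to each point p the order k_p of
   omega at p and a complex coordinate z_p centred at p in which omega has its
   normal form omega = d(z_p ^ (k_p + 1)); only the germ of z_p at p matters.
   [ts_compat] says that the local primitives z_p ^ (k_p + 1) of omega differ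
   by constants where they overlap.  It makes omega well defined, makes the
   coordinate changes translations away from the zeros of omega, and hence
   holomorphic everywhere (the zeros are isolated). *)
Record translation_surface (R : realType) := TranslationSurface {
  ts_space :> topologicalType ;
  ts_nonempty : [set: ts_space] !=set0 ;
  ts_hausdorff : hausdorff_space ts_space ;
  ts_compact : compact [set: ts_space] ;
  ts_connected : connected [set: ts_space] ;
  ts_order : ts_space -> nat ;
  ts_coord : ts_space -> ts_space -> plane R ;
  ts_coord0 : forall p, ts_coord p p = 0 ;
  ts_coord_homeo : forall p, exists U : set ts_space,
    [/\ open U, U p,
        (forall x, U x -> {for x, continuous (ts_coord p)}),
        {in U &, injective (ts_coord p)} &
        forall V, open V -> V `<=` U -> open (ts_coord p @` V)] ;
  ts_compat : forall p, \forall q \near p, \forall x \near q,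
    ts_coord p x ^+ (ts_order p).+1 - ts_coord p q ^+ (ts_order p).+1
    = ts_coord q x ^+ (ts_order q).+1
}.

(* The primitive of omega near p that vanishes at p. *)
Definition ts_prim (R : realType) (M : translation_surface R) (p x : M) :
  plane R := ts_coord p x ^+ (ts_order p).+1.

(* The genus, in Riemann's sense: the largest number of pairwise disjoint
   simple closed curves whose union does not disconnect the surface. *)
Definition nonseparating_curves (R : realType) (X : topologicalType) (n : nat) :=
  exists c : 'I_n -> R -> X,
    [/\ forall i, {within `[0, 1], continuous (c i)},
        forall i, c i 0 = c i 1,
        forall i j (s t : R), 0 <= s < 1 -> 0 <= t < 1 ->
          c i s = c j t -> i = j /\ s = t &
        connected (~` \bigcup_i (c i @` `[0, 1]))].

Definition has_genus (R : realType) (X : topologicalType) (g : nat) :=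
  nonseparating_curves R X g /\
  forall n, (g < n)%N -> ~ nonseparating_curves R X n.

(* M lies in H(g-1, g-1), with A and B its two zeros. *)
Definition in_stratum (R : realType) (g : nat) (M : translation_surface R)
    (A B : M) :=
  [/\ has_genus R M g, A <> B, ts_order A = g.-1, ts_order B = g.-1 &
      forall p : M, p <> A -> p <> B -> ts_order p = 0%N].

(* Holomorphic maps from M to the Riemann sphere, the latter being
   [option R[i]] with [None] the point at infinity: near each point, phi is G
   or 1/G for a holomorphic function G of the local coordinate. *)
Definition holomorphic_to_sphere (R : realType) (M : translation_surface R)
    (phi : M -> option R[i]) :=
  forall p : M, exists G : plane R -> plane R,
    (\forall w \near (0 : plane R), derivable G w 1) /\
    ((\forall x \near p, phi x = Some (G (ts_coord p x))) \/
     (\forall x \near p, phi x = if G (ts_coord p x) == 0 then None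
                                 else Some (G (ts_coord p x))^-1)).

(* J exchanges the two sheets of a degree two holomorphic map from M to the
   Riemann sphere. *)
Definition hyperelliptic_involution (R : realType) (M : translation_surface R)
    (J : M -> M) :=
  (exists x, J x <> x) /\
  exists2 phi : M -> option R[i], holomorphic_to_sphere phi &
    forall x y, phi x = phi y <-> y = x \/ y = J x.

Definition in_hyperelliptic_component (R : realType) (g : nat)
    (M : translation_surface R) :=
  exists A B : M, in_stratum g A B /\
    exists2 J : M -> M, hyperelliptic_involution J & J A = B /\ J B = A.

(* The cross product of z and w, as vectors of the real plane. *)
Definition cross (R : realType) (z w : R[i]) : R :=
  complex.Re z * complex.Im w - complex.Im z * complex.Re w.

(* T is C / Lambda for the lattice Lambda spanned by a and b, with the 1-form
   induced by dz; u is the quotient map. *)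
Definition is_torus (R : realType) (T : translation_surface R) :=
  exists a b : R[i], cross a b != 0 /\
  exists u : plane R -> T,
    [/\ continuous u,
        forall t, exists z, u z = t,
        (forall z w, u z = u w <->
           exists m n : int, w - z = a *~ m + b *~ n) &
        forall z : plane R, \forall w \near z, ts_prim (u z) (u w) = w - z].

(* f pulls the 1-form of N back to that of M. *)
Definition translation_map (R : realType) (M N : translation_surface R)
    (f : M -> N) :=
  continuous f /\
  forall p : M, \forall x \near p, ts_prim (f p) (f x) = ts_prim p x.

Definition ramified (X Y : topologicalType) (f : X -> Y) (p : X) :=
  ~ exists2 U, nbhs p U & {in U &, injective f}.

Definition branch_points (X Y : topologicalType) (f : X -> Y) : set Y :=
  f @` [set p | ramified f p].

(* A nonconstant holomorphic map of compact Riemann surfaces is a covering away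
   from its branch points; its degree is the number of sheets. *)
Definition translation_cover (R : realType) (d : nat)
    (M N : translation_surface R) (f : M -> N) :=
  translation_map f /\
  forall t : N, ~ branch_points f t -> f @^-1` [set t] #= `I_d.

(* The locus C^(d)(g-1, g-1). *)
Definition hurwitz_locus (R : realType) (d g : nat) (M : translation_surface R) :=
  in_hyperelliptic_component g M /\
  exists2 T : translation_surface R, is_torus T &
    exists2 f : M -> T, translation_cover d f & branch_points f #= `I_2.

(* The i-th edge goes from v i to v (ordS i), indices being cyclic. *)
Definition edge_vector (R : realType) (n : nat) (v : 'I_n -> R[i]) (i : 'I_n) :
  R[i] := v (ordS i) - v i.

Definition edge (R : realType) (n : nat) (v : 'I_n -> R[i]) (i : 'I_n) :
    set R[i] :=
  [set v i + t%:C * edge_vector v i | t in `[0, 1]].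

(* The convex hull of the vertices. *)
Definition polygon (R : realType) (n : nat) (v : 'I_n -> R[i]) :
    set (plane R) :=
  [set z | exists l : 'I_n -> R,
     [/\ forall i, 0 <= l i, \sum_i l i = 1 & z = \sum_i (l i)%:C * v i]].

(* The v i are, in counterclockwise order, the vertices of a convex polygon
   (which lies to the left of each of its edges) whose internal angles are
   less than pi (the boundary makes a strict left turn at each vertex). *)
Definition strictly_convex (R : realType) (n : nat) (v : 'I_n -> R[i]) :=
  [/\ (3 <= n)%N, injective v,
      forall i j, 0 <= cross (edge_vector v i) (v j - v i) &
      forall i, 0 < cross (edge_vector v i) (edge_vector v (ordS i))].

(* The edges i and s i are parallel, of equal length and, along the boundary,
   of opposite direction, so that a translation identifies them with the
   polygon on either side. *)
Definition edge_pairing (R : realType) (n : nat) (v : 'I_n -> R[i])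
    (s : 'I_n -> 'I_n) :=
  forall i, [/\ s (s i) = i, s i <> i &
                edge_vector v (s i) = - edge_vector v i].

(* The translation taking the edge i to the edge s i sends the origin v i of
   the former to the end point of the latter. *)
Definition glue (R : realType) (n : nat) (v : 'I_n -> R[i])
    (s : 'I_n -> 'I_n) (x y : R[i]) : Prop :=
  exists2 i, edge v i x & y = x + (v (ordS (s i)) - v i).

(* The map q identifies M, with its 1-form, with the quotient of the polygon
   by the equivalence relation generated by the gluing of its edges. *)
Definition has_strictly_convex_presentation (R : realType)
    (M : translation_surface R) :=
  exists (n : nat) (v : 'I_n -> R[i]) (s : 'I_n -> 'I_n),
    strictly_convex v /\ edge_pairing v s /\
    exists q : plane R -> M,
    [/\ {within polygon v, continuous q},
        q @` polygon v = [set: M],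
        (forall x y, polygon v x -> polygon v y ->
           (q x = q y <-> clos_refl_sym_trans _ (glue v s) x y)) &
        forall x, polygon v x -> \forall y \near x, polygon v y ->
          ts_prim (q x) (q y) = y - x].

(* Main.v *)
(** Take d0 = g.  A degree g translation cover f of a torus C/Lambda is totally
    ramified at a zero A of order g - 1, so A is the only point of its fibre:
    another one would give a (g+1)-st preimage of some unbranched point near
    f(A).  In a strictly convex polygon presenting M, the points over A are
    therefore exactly the polygon points in one translate of Lambda.  All of
    them are vertices: the cone angle at A is 2 pi g >= 4 pi, while a point of
    the polygon other than a vertex becomes a point of cone angle 2 pi.  As the
    corners at A add up to 2 pi g and each is smaller than pi, there are at
    least 2g + 1 >= 5 of them, hence two are congruent modulo 2 Lambda.  Their
    midpoint lies in the same translate and in the polygon, but is not a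
    vertex. *)
Require Import Defs.
From HB Require Import structures.
From mathcomp Require Import all_boot all_order all_algebra.
From mathcomp Require Import complex.
From mathcomp Require Import all_classical all_reals all_analysis.
From mathcomp Require separable cyclotomic.
From mathcomp Require Import ring lra zify.

Set Implicit Arguments.
Unset Strict Implicit.
Unset Printing Implicit Defensive.

Import Order.TTheory GRing.Theory Num.Theory.
Import numFieldNormedType.Exports.

Local Open Scope classical_set_scope.
Local Open Scope card_scope.
Local Open Scope complex_scope.
Local Open Scope ring_scope.

(** * Linear algebra of the cross product *)

Section Cross.
Variable R : realType.
Implicit Types (z w : R[i]) (t : R).

Lemma crossDr z w w' : cross z (w + w') = cross z w + cross z w'.
Proof. by case: z w w' => [a b] [c d] [e f]; rewrite /cross /=; ring. Qed.

Lemma crossZr z t w : cross z (t%:C * w) = t * cross z w.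
Proof. by case: z w => [a b] [c d]; rewrite /cross /=; ring. Qed.

Lemma crossNr z w : cross z (- w) = - cross z w.
Proof. by case: z w => [a b] [c d]; rewrite /cross /=; ring. Qed.

Lemma crossC z w : cross z w = - cross w z.
Proof. by case: z w => [a b] [c d]; rewrite /cross /=; ring. Qed.

Lemma crosszz z : cross z z = 0.
Proof. by case: z => [a b]; rewrite /cross /=; ring. Qed.

Lemma crossr0 z : cross z 0 = 0.
Proof. by rewrite /cross /= !mulr0 subrr. Qed.

Lemma cross_sumr z (I : finType) (F : I -> R[i]) :
  cross z (\sum_i F i) = \sum_i cross z (F i).
Proof. exact: (big_morph _ (crossDr z) (crossr0 z)). Qed.

(** Cramer's rule for the real basis [a], [b] of the plane. *)
Lemma cross_basis a b z : cross a b != 0 ->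
  z = (cross z b / cross a b)%:C * a + (cross a z / cross a b)%:C * b.
Proof.
case: a b z => [a a'] [b b'] [z z']; rewrite /cross /= => h.
by apply/eqP; rewrite eq_complex /=; apply/andP; split; apply/eqP; field.
Qed.

Lemma cross_indep a b w : cross a b != 0 -> cross a w = 0 -> cross b w = 0 ->
  w = 0.
Proof.
move=> ab aw bw; rewrite (cross_basis w ab) aw (crossC w) bw.
by rewrite oppr0 !mul0r ?raddf0 ?mul0r addr0.
Qed.

Lemma cross_eq0_colinear z w : z != 0 -> cross z w = 0 ->
  exists t : R, w = t%:C * z.
Proof.
case: z w => [a b] [c d]; rewrite eq_complex /= /cross /= => zn0 h.
have n0 : a ^+ 2 + b ^+ 2 != 0.
  by apply: contra zn0; rewrite paddr_eq0 ?sqr_ge0// !sqrf_eq0.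
(* The coefficient of the orthogonal projection of [w] onto [z]. *)
exists ((a * c + b * d) / (a ^+ 2 + b ^+ 2)).
have e1 : (a * c + b * d) * a = c * (a ^+ 2 + b ^+ 2).
  by rewrite -[RHS]addr0 -(mulr0 b) -h; ring.
have e2 : (a * c + b * d) * b = d * (a ^+ 2 + b ^+ 2).
  by rewrite -[RHS]subr0 -(mulr0 a) -h; ring.
apply/eqP; rewrite eq_complex /= !mul0r subr0 addr0.
by rewrite !(mulrAC _ _^-1) e1 e2 !mulfK ?eqxx.
Qed.

End Cross.

(** * Strictly convex polygons: supporting lines, vertices and edges *)

Section Polygon.
Variables (R : realType) (n : nat) (v : 'I_n -> R[i]).
Implicit Types (i j : 'I_n) (x y w : R[i]).

Lemma polygon_vertex i : polygon v (v i).
Proof.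
exists (fun j => (j == i)%:R); split=> [j||]; first by case: eqP.
  by rewrite (bigD1 i)//= eqxx big1 ?addr0// => j /negbTE->.
rewrite (bigD1 i)//= eqxx big1 ?addr0 ?mul1r//.
by move=> j /negbTE->; rewrite raddf0 mul0r.
Qed.

Lemma polygon_convex x y t : polygon v x -> polygon v y -> 0 <= t <= 1 ->
  polygon v (x + t%:C * (y - x)).
Proof.
move=> [l [l0 l1 ->]] [m [m0 m1 ->]] /andP[t0 t1].
exists (fun i => (1 - t) * l i + t * m i); split.
- by move=> i; rewrite addr_ge0// mulr_ge0// subr_ge0.
- by rewrite big_split/= -!mulr_sumr l1 m1 !mulr1 subrK.
rewrite -sumrB mulr_sumr -big_split/=; apply: eq_bigr => i _.
by rewrite raddfD /= !rmorphM rmorphB rmorph1; ring.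
Qed.

Lemma edge_vector_pred i : edge_vector v (ord_pred i) = v i - v (ord_pred i).
Proof. by rewrite /edge_vector ord_predK. Qed.

Lemma edge_line j x : edge v j x -> cross (edge_vector v j) (x - v j) = 0.
Proof. by move=> [t _ <-]; rewrite addrC addKr crossZr crosszz mulr0. Qed.

Section Convex.
Hypothesis convex_v : strictly_convex v.

Lemma cross_pred_gt0 i :
  0 < cross (edge_vector v (ord_pred i)) (edge_vector v i).
Proof. by case: convex_v => _ _ _ /(_ (ord_pred i)); rewrite ord_predK. Qed.

Lemma edge_vector_neq0 i : edge_vector v i != 0.
Proof.
by apply/eqP => e0; have := cross_pred_gt0 i; rewrite e0 crossr0 ltxx.
Qed.

Lemma polygon_left i x : polygon v x ->
  0 <= cross (edge_vector v i) (x - v i).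
Proof.
move=> [l [l0 l1 ->]].
have -> : \sum_j (l j)%:C * v j - v i = \sum_j (l j)%:C * (v j - v i).
  under [RHS]eq_bigr do rewrite mulrBr.
  by rewrite sumrB -mulr_suml -raddf_sum /= l1 rmorph1 mul1r.
rewrite cross_sumr sumr_ge0// => j _; rewrite crossZr mulr_ge0//.
by case: convex_v.
Qed.

Lemma polygon_left_pred i x : polygon v x ->
  0 <= cross (edge_vector v (ord_pred i)) (x - v i).
Proof.
move=> /(polygon_left (ord_pred i)).
set p := ord_pred i; have -> : x - v p = (x - v i) + edge_vector v p.
  by rewrite edge_vector_pred addrA subrK.
by rewrite crossDr crosszz addr0.
Qed.

(** Both edges at [v i] have the polygon on their left, so [w] and [- w] have nonnegative cross
    products with each of them. These products vanish, and the two edges are independent. *)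
Lemma vertex_extreme i w (s t : R) : 0 < s -> 0 < t ->
  polygon v (v i + s%:C * w) -> polygon v (v i - t%:C * w) -> w = 0.
Proof.
move=> s0 t0 p1 p2.
apply: (cross_indep (lt0r_neq0 (cross_pred_gt0 i))).
  move: (polygon_left_pred i p1) (polygon_left_pred i p2).
  by rewrite ![v i + _]addrC !addrK crossNr !crossZr; nra.
move: (polygon_left i p1) (polygon_left i p2).
by rewrite ![v i + _]addrC !addrK crossNr !crossZr; nra.
Qed.

(** Write [v i] as [v j] plus [t] times the edge [j]. The edges before and after [j] confine [t] to
    the unit interval; strictly inside it, [v i] would lie between two other points of the polygon,
    against [vertex_extreme]. *)
Lemma vertex_on_edge_line i j :
  cross (edge_vector v j) (v i - v j) = 0 -> i = j \/ i = ordS j.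
Proof.
case: (convex_v) => _ v_inj left turn.
move=> /(cross_eq0_colinear (edge_vector_neq0 j))[t vij].
have t0 : 0 <= t.
  have := polygon_left_pred j (polygon_vertex i).
  by rewrite vij crossZr; have := cross_pred_gt0 j; nra.
have vSj : v i - v (ordS j) = (t - 1)%:C * edge_vector v j.
  by rewrite rmorphB rmorph1 mulrBl mul1r -vij /edge_vector opprB addrA subrK.
have t1 : t <= 1.
  have := left (ordS j) i; rewrite vSj crossZr crossC.
  by have := turn j; nra.
have [t00|tn0] := eqVneq t 0.
  by left; apply: v_inj; apply/subr0_eq; rewrite vij t00 mul0r.
have [t11|tn1] := eqVneq t 1.
  by right; apply: v_inj; apply/subr0_eq; rewrite vSj t11 subrr mul0r.
have /eqP : edge_vector v j = 0.
  apply: (@vertex_extreme i _ (1 - t) t).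
  - by rewrite subr_gt0 lt_neqAle tn1.
  - by rewrite lt_neqAle eq_sym tn0.
  - rewrite -(opprB t 1) rmorphN mulNr -vSj subKr; exact: polygon_vertex.
  - by rewrite -vij subKr; exact: polygon_vertex.
by rewrite (negbTE (edge_vector_neq0 j)).
Qed.

(** The line of the edge [j] supports the polygon, so if it contains an interior point of the edge
    [i], it contains both ends of that edge. These are then ends of [j], and the strict turns
    exclude every case but [i = j]. *)
Lemma edge_interior_unique i j (t : R) : 0 < t < 1 ->
  edge v j (v i + t%:C * edge_vector v i) -> i = j.
Proof.
case: (convex_v) => _ v_inj left turn.
move=> /andP[t0 t1] /edge_line h.
have [/vertex_on_edge_line hi /vertex_on_edge_line hS] :
    cross (edge_vector v j) (v i - v j) = 0 /\
    cross (edge_vector v j) (v (ordS i) - v j) = 0.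
  have := left j (ordS i); have := left j i; move: h.
  set a := v i - v j.
  have -> : v i + t%:C * edge_vector v i - v j = a + t%:C * edge_vector v i.
    by rewrite addrAC.
  have -> : v (ordS i) - v j = a + edge_vector v i.
    by rewrite /edge_vector /a; ring.
  move: a (edge_vector v i) => a e.
  rewrite !crossDr crossZr => h a0 b0.
  have /eqP : (1 - t) * cross (edge_vector v j) a +
      t * (cross (edge_vector v j) a + cross (edge_vector v j) e)
      = 0 by rewrite -[RHS]h; ring.
  have t1' : 0 < 1 - t by rewrite subr_gt0.
  rewrite paddr_eq0; first last.
  - exact: mulr_ge0 (ltW t0) b0.
  - exact: mulr_ge0 (ltW t1') a0.
  by rewrite !mulf_eq0 (gt_eqF t1') (gt_eqF t0)/= => /andP[/eqP ? /eqP].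
case: hi => // iE; case: hS => SiE.
  have eN : edge_vector v (ordS j) = - edge_vector v j.
    by rewrite /edge_vector -iE SiE opprB.
  by have := turn j; rewrite eN crossNr crosszz oppr0 ltxx.
by have := edge_vector_neq0 i; rewrite /edge_vector SiE -iE subrr eqxx.
Qed.

End Convex.
End Polygon.

(** * Gluing classes of the points that are not vertices *)

Section Gluing.
Variables (R : realType) (n : nat) (v : 'I_n -> R[i]) (s : 'I_n -> 'I_n).
Hypotheses (convex_v : strictly_convex v) (pairing : edge_pairing v s).

Let shift i := v (ordS (s i)) - v i.

Lemma glue_edge i (t : R) : 0 <= t <= 1 ->
  edge v i (v i + t%:C * edge_vector v i).
Proof. by move=> ht; exists t. Qed.

(** Paired edges run in opposite directions, so the gluing turns the parameter [t] into [1 - t]. *)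
Lemma shift_edge i (t : R) : v i + t%:C * edge_vector v i + shift i =
  v (s i) + (1 - t)%:C * edge_vector v (s i).
Proof.
have [_ _ eN] := pairing i.
have -> : shift i = v (s i) + edge_vector v (s i) - v i.
  by rewrite /shift /edge_vector; ring.
by rewrite eN rmorphB rmorph1; ring.
Qed.

Lemma glue_sym x y : Defs.glue v s x y -> Defs.glue v s y x.
Proof.
move=> [i [t /= ht <-]]; rewrite -/(shift i) shift_edge => ->.
have [ssi _ eN] := pairing i.
exists (s i).
  by apply: glue_edge; move: ht; rewrite in_itv /= subr_ge0 lerBlDr lerDl andbC.
rewrite -/(shift (s i)) shift_edge ssi; congr (_ + _%:C * _); ring.
Qed.

Lemma glue_class_closed (C : R[i] -> Prop) x y :
  (forall a b, Defs.glue v s a b -> C a -> C b) ->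
  Relation_Operators.clos_refl_sym_trans _ (Defs.glue v s) x y -> C x -> C y.
Proof.
move=> closedC xy.
(* The symmetric closure makes the induction need both implications. *)
suff [] : (C x -> C y) /\ (C y -> C x) by [].
elim: xy => [a b ab|//|a b _ []//|a b c _ [h1 h2] _ [h3 h4]].
- by split; apply: closedC => //; exact: glue_sym.
- by split => h; [exact: h3 (h1 h)|exact: h2 (h4 h)].
Qed.

Lemma interior_class x y : (forall i, ~ edge v i x) ->
  Relation_Operators.clos_refl_sym_trans _ (Defs.glue v s) x y -> y = x.
Proof.
move=> xNedge xy.
apply: (glue_class_closed (C := fun z => z = x)) xy erefl => a b.
by move=> [i ai _] ax; rewrite ax in ai; case: (xNedge i).
Qed.

(** The pair of [x] and its translate is closed under gluing: each lies inside a single edge, and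
    [s] is an involution. *)
Lemma edge_interior_class i x y : edge v i x -> (forall k, x <> v k) ->
  Relation_Operators.clos_refl_sym_trans _ (Defs.glue v s) x y ->
  y = x \/ y = x + shift i.
Proof.
move=> [t /= ht <-] nv; move: ht; rewrite in_itv/= => /andP[t0 t1].
have {}t0 : 0 < t.
  rewrite lt_neqAle t0 andbT; apply/eqP => t00.
  by apply: (nv i); rewrite -t00 mul0r addr0.
have {}t1 : t < 1.
  rewrite lt_neqAle t1 andbT; apply/eqP => t11.
  by apply: (nv (ordS i)); rewrite t11 mul1r addrC subrK.
move: nv => _; set x0 := v i + _ => xy.
apply: (glue_class_closed (C := fun z => z = x0 \/ z = x0 + shift i)) xy _;
  last by left.
move=> a b [j aj ->]; rewrite -/(shift j) => -[]aE; rewrite aE in aj *.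
  by right; rewrite -(edge_interior_unique convex_v _ aj)// t0.
left; move: aj; rewrite shift_edge => /(edge_interior_unique convex_v) <-.
  have [ssi _ _] := pairing i.
  by rewrite shift_edge ssi /x0; congr (_ + _%:C * _); ring.
by rewrite subr_gt0 t1 ltrBlDr ltrDl t0.
Qed.

End Gluing.

(** * Semicontinuity of fibres *)

Section Topology.

(* A continuous map on a compact set is closed, so its fibres vary upper
   semicontinuously. *)
Lemma compact_fiber_near (X Y : topologicalType) (K N : set X) (q : X -> Y)
    (p : Y) :
  hausdorff_space Y -> compact K -> {within K, continuous q} -> open N ->
  (forall y, K y -> q y = p -> N y) ->
  \forall x \near p, forall y, K y -> q y = x -> N y.
Proof.
move=> hY cK cq oN KN.
have cKN : compact (K `&` ~` N).
  by apply: compact_closedI => //; exact: open_closedC.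
have cl : closed (q @` (K `&` ~` N)).
  apply: compact_closed => //; apply: continuous_compact cKN.
  by apply: continuous_subspaceW cq => x [].
have : nbhs p (~` (q @` (K `&` ~` N))).
  apply: open_nbhs_nbhs; split; first exact: closed_openC.
  by move=> [y [Ky nNy] qy]; apply: nNy; exact: KN.
apply: filterS => x xn y Ky qy; apply: contrapT => nNy; apply: xn.
by exists y.
Qed.

End Topology.

(** * Rays and roots in the complex plane *)

Section ComplexPlane.
Variable R : realType.

Lemma gt0_complex (e : R[i]) : 0 < e -> exists2 r : R, 0 < r & e = r%:C.
Proof.
case: e => r r'; rewrite ltcE /= => /andP[/eqP -> r0].
by exists r.
Qed.

Lemma norm_real_complex (t : R) : `|t%:C| = `|t|%:C.
Proof. by rewrite normc_def /= expr0n /= addr0 sqrtr_sqr. Qed.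

Lemma real_complex_continuous : continuous (fun t : R => t%:C : plane R).
Proof.
move=> t; apply/cvgrPdist_lt => e /gt0_complex[r r0 ->].
near=> t'; rewrite -rmorphB norm_real_complex ltcR.
near: t'; exact: cvgr_dist_lt.
Unshelve. all: by end_near. Qed.

Lemma line_continuous (x w : plane R) :
  continuous (fun t : R => x + t%:C * w : plane R).
Proof.
move=> t; apply: cvgD; first exact: cvg_cst.
by apply: cvgM; [exact: real_complex_continuous|exact: cvg_cst].
Qed.

Lemma near0_ray (P : set (plane R)) (w : plane R) :
  (\forall c \near (0 : plane R), P c) ->
  exists2 e : R, 0 < e & P (e%:C * w).
Proof.
move=> nP.
have c0 : (fun t : R => 0 + t%:C * w : plane R) @ (0 : R) --> (0 : plane R).
  have := @line_continuous 0 w 0; rewrite /continuous_at.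
  by rewrite mul0r addr0.
have : \forall t \near (0 : R)^'+, 0 < t /\ P (t%:C * w).
  near=> t; split; first by near: t; exact: nbhs_right_gt.
  rewrite -[_ * _]add0r; near: t.
  by apply: (cvg_at_right_filter c0).
by move=> /filter_ex [e [e0 Pe]]; exists e.
Unshelve. all: by end_near. Qed.

(** One root of [c] is multiplied by the roots of unity, which are distinct because ['X^(n.+1) - 1]
    is separable. *)
Lemma complex_roots (n : nat) (c : R[i]) : c != 0 ->
  exists y : 'I_n.+1 -> R[i], injective y /\ forall i, y i ^+ n.+1 = c.
Proof.
move=> c0.
have [r rE] := closed_field_poly_normal ('X^(n.+1) - 1%:P : {poly R[i]}).
rewrite (monicP (monicXnsubC _ _))// scale1r in rE.
have sr : size r = n.+1.
  have := size_XnsubC (1 : R[i]) (ltn0Sn n).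
  by rewrite rE size_prod_XsubC => -[].
have ur : uniq r.
  rewrite -separable.separable_prod_XsubC -rE polyC1.
  by rewrite cyclotomic.separable_Xn_sub_1.
pose y0 := n.+1.-root c.
have y0E : y0 ^+ n.+1 = c by exact: rootCK.
have y00 : y0 != 0 by apply: contra_neq c0 => y00; rewrite -y0E y00 expr0n.
exists (fun i => y0 * r`_i); split=> [i j /(mulfI y00)/eqP|i].
  by rewrite nth_uniq ?sr// => /eqP/val_inj.
rewrite exprMn y0E.
have : root ('X^(n.+1) - 1%:P) r`_i.
  by rewrite rE root_prod_XsubC mem_nth// sr.
by rewrite rootE !hornerE subr_eq0 => /eqP->; rewrite mulr1.
Qed.

End ComplexPlane.

(** * Local degree of the primitive of the 1-form *)

Section Preimages.
Variables (R : realType) (M : translation_surface R).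

Lemma ts_prim0 (p : M) : ts_prim p p = 0.
Proof. by rewrite /ts_prim ts_coord0 expr0n. Qed.

(** The roots of a small [c] are all small, and the chart at [p] is open, so each root is the
    coordinate of a point of [U]. *)
Lemma prim_preimages (p : M) (U : set M) : nbhs p U ->
  \forall c \near (0 : plane R), c != 0 ->
  exists x : 'I_(ts_order p).+1 -> M,
    injective x /\ forall i, U (x i) /\ ts_prim p (x i) = c.
Proof.
move=> /nbhs_interior/nbhs_singleton Up.
have [V [oV Vp _ _ openV]] := ts_coord_homeo p.
have : nbhs (0 : plane R) (ts_coord p @` (V `&` U^°)).
  apply: open_nbhs_nbhs; split; last by exists p => //; exact: ts_coord0.
  apply: openV; last by move=> x [].
  by apply: openI => //; exact: open_interior.
move=> /nbhs_ballP[e /= e0 be].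
have e0' : 0 < e ^+ (ts_order p).+1 by rewrite exprn_gt0.
near=> c => c0.
have [y [y_inj yE]] := complex_roots (ts_order p) c0.
have /choice[x xE] : forall i, exists x : M,
    (V `&` U^°) x /\ ts_coord p x = y i.
  move=> i; have [|x] := be (y i); last by move=> Vx <-; exists x.
  rewrite -ball_normE /ball_ /= sub0r normrN.
  rewrite -(@ltr_pXn2r _ (ts_order p).+1)// ?nnegrE// ?ltW//.
  rewrite -normrX yE -normrN -sub0r.
  by near: c; exact: cvgr_dist_lt.
exists x; split=> [i j xij|i].
  by apply: y_inj; rewrite -(xE i).2 -(xE j).2 xij.
have [[_ Ux] xi] := xE i; split; first exact: interior_subset Ux.
by rewrite /ts_prim xi yE.
Unshelve. all: by end_near. Qed.

End Preimages.

(** * Local inverse of the quotient map onto the torus *)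

Section Torus.
Variables (R : realType) (T : translation_surface R) (a b : R[i]).
Variable u : plane R -> T.
Hypotheses (ab : cross a b != 0) (u_cont : continuous u).
Hypothesis u_surj : forall t, exists z, u z = t.
Hypothesis u_lattice : forall z w, u z = u w <->
  exists m n : int, w - z = a *~ m + b *~ n.
Hypothesis u_prim : forall z : plane R,
  \forall w \near z, ts_prim (u z) (u w) = w - z.

(** [u_prim] gives the identity for images of points near [z]. What remains is that every [t] near
    [u z] has a lift near [z]; this follows from semicontinuity of the fibres of [u] on a compact
    fundamental domain. *)
Lemma torus_local_inverse (z : plane R) :
  \forall t \near u z, t = u (z + ts_prim (u z) t).
Proof.
(* The fundamental parallelogram; rounding coordinates down shows that it maps onto the torus. *)
pose K : set (plane R) :=
  (fun p : R * R => p.1%:C * a + p.2%:C * b) @` (`[0, 1] `*` `[0, 1]).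
have cK : compact K.
  apply: continuous_compact.
    apply: continuous_subspaceT => -[s t].
    apply: (@cvgD R[i] (plane R)); apply: cvgM; try exact: cvg_cst;
      apply: continuous_comp; try exact: real_complex_continuous.
      exact: cvg_fst.
    exact: cvg_snd.
  by apply: compact_setX; exact: segment_compact.
have K_surj t : exists2 y, K y & u y = t.
  have [y <-] := u_surj t; rewrite (cross_basis y ab).
  set s1 := _ / _; set s2 := _ / _.
  exists ((s1 - (Num.floor s1)%:~R)%:C * a + (s2 - (Num.floor s2)%:~R)%:C * b).
    exists (s1 - (Num.floor s1)%:~R, s2 - (Num.floor s2)%:~R) => //=.
    by split; rewrite /= in_itv /= subr_ge0 floor_le lerBlDr ltW// addrC
      -[1]/(1%:~R) -intrD floorD1_gt.
  apply/u_lattice; exists (Num.floor s1), (Num.floor s2).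
  have sub_int (s : R) (m : int) (c : R[i]) :
      (s - m%:~R)%:C * c = s%:C * c - c *~ m.
    by rewrite raddfB /= rmorph_int mulrBl mulrzl.
  by rewrite !sub_int addrACA -opprD subKr.
have := u_prim z; rewrite -nbhs_nearE => /nbhs_interior/nbhs_singleton Wz.
set W := _^° in Wz.
(* All lattice translates of [W]: an open set containing the whole fibre of [u z]. *)
pose N := \bigcup_(mn in [set: int * int])
  ((fun y : plane R => y + (a *~ mn.1 + b *~ mn.2)) @^-1` W).
have oN : open N.
  apply: bigcup_open => mn _; apply: open_comp; last exact: open_interior.
  move=> y _; apply: (@cvgD R[i] (plane R) _ (nbhs y)); first exact: cvg_id.
  exact: cvg_cst.
have : \forall t \near u z, forall y, K y -> u y = t -> N y.
  apply: compact_fiber_near => //; first exact: ts_hausdorff.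
    exact: continuous_subspaceT.
  move=> y _ /u_lattice [m [n zy]]; exists (m, n); first by [].
  by rewrite /preimage/mkset/= -zy addrC subrK.
apply: filterS => t tN.
have [y Ky uy] := K_surj t.
have [[m n] _ /= Wy] := tN y Ky uy.
have uyE : u (y + (a *~ m + b *~ n)) = t.
  by rewrite -uy; apply/esym/u_lattice; exists m, n; rewrite addrC addKr.
by have /= := interior_subset Wy; rewrite uyE => ->; rewrite addrC subrK uyE.
Qed.

End Torus.

(** * Auxiliary facts on neighbourhoods, finite fibres and connectedness *)

Lemma dnbhs0_pick3 (R : realType) (A B C : set (plane R)) :
  (\forall c \near (0 : plane R), c != 0 -> A c) ->
  (\forall c \near (0 : plane R), c != 0 -> B c) ->
  (\forall c \near (0 : plane R), c != 0 -> C c) ->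
  exists c, [/\ A c, B c & C c].
Proof.
move=> nA nB nC.
have : \forall c \near (0 : plane R), c != 0 -> [/\ A c, B c & C c].
  by apply: filterS3 nA nB nC => c hA hB hC c0;
     split; [exact: hA|exact: hB|exact: hC].
move=> /(near0_ray 1)[e e0 h]; exists (e%:C * 1); apply: h.
by rewrite mulr1 eq_complex /= eqxx andbT gt_eqF.
Qed.

Lemma continuous_near (X Y : topologicalType) (f : X -> Y) (x : X) (V : set Y) :
  {for x, continuous f} -> (\forall y \near f x, V y) ->
  \forall y \near x, V (f y).
Proof. by move=> fc; exact: fc. Qed.

Lemma within_continuous_near (X Y : topologicalType) (P : set X) (f : X -> Y)
    (x : X) (V : set Y) :
  {within P, continuous f} -> P x -> (\forall y \near f x, V y) ->
  \forall y \near x, P y -> V (f y).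
Proof. by move=> /subspace_continuousP fc Px; exact: fc. Qed.

Lemma near_shift (R : realType) (z : plane R) (P : set (plane R)) :
  (\forall w \near z, P w) -> \forall c \near (0 : plane R), P (z + c).
Proof.
move=> nP.
suff : (fun c : plane R => z + c) @ nbhs (0 : plane R) --> z by exact.
rewrite -[X in _ --> X]addr0.
by apply: (@cvgD R[i] (plane R) _ (nbhs 0)); [exact: cvg_cst|exact: cvg_id].
Qed.

Lemma card_fiber_bound (X : Type) (I : finType) (F : set X) (d : nat)
    (y : I -> X) :
  F #= `I_d -> injective y -> (forall i, F (y i)) -> (#|I| <= d)%N.
Proof.
move=> /card_set_bijP[h [hF h_inj _]] y_inj Fy.
pose k i : 'I_d := Ordinal (hF _ (Fy i)).
rewrite -[d]card_ord; apply: (@leq_card _ _ k) => i j /(congr1 val)/= hij.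
by apply: y_inj; apply: h_inj => //; rewrite inE.
Qed.

Lemma connected_locally_constant (X : topologicalType) (A S : set X) (s t : X) :
  connected A ->
  (forall x, A x -> \forall y \near x, A y -> (S y <-> S x)) ->
  A s -> A t -> S s -> S t.
Proof.
move=> cA lc As At Ss.
suff AS : A `&` S = A by move: At; rewrite -{1}AS => -[].
apply: cA; first by exists s.
(* Local constancy makes the trace of [S] on [A] both relatively open and relatively closed. *)
- exists (~` A `|` S)°; first exact: open_interior.
  apply/seteqP; split=> x [Ax Sx]; split=> //.
    by apply: filterS (lc x Ax) => y h; case: (pselect (A y)) => [/h[_ h2]|];
      [right; exact: h2|left].
  by have [] := interior_subset Sx.
- exists (~` (~` A `|` ~` S)°); first exact: open_closedC (open_interior _).
  apply/seteqP; split=> x [Ax Sx]; split=> //.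
    by move/interior_subset => [].
  apply: contrapT => nSx; apply: Sx.
  by apply: filterS (lc x Ax) => y h; case: (pselect (A y)) => [/h[h1 _]|];
    [right => /h1|left].
Qed.

(** * Translation covers of a torus: total ramification and development *)

Section Cover.
Variables (R : realType) (M T : translation_surface R) (a b : R[i]).
Variable u : plane R -> T.
Hypotheses (ab : cross a b != 0) (u_cont : continuous u).
Hypothesis u_surj : forall t, exists z, u z = t.
Hypothesis u_lattice : forall z w, u z = u w <->
  exists m n : int, w - z = a *~ m + b *~ n.
Hypothesis u_prim : forall z : plane R,
  \forall w \near z, ts_prim (u z) (u w) = w - z.
Variables (f : M -> T) (d : nat).
Hypothesis f_transl : translation_map f.

Lemma translation_map_local p z : u z = f p ->
  \forall x \near p, f x = u (z + ts_prim p x).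
Proof.
move=> uz; have [f_cont f_prim] := f_transl.
have near_f : \forall x \near p, f x = u (z + ts_prim (u z) (f x)).
  apply: (continuous_near (f_cont p)
    (V := [set t | t = u (z + ts_prim (u z) t)])).
  rewrite -uz.
  exact: (torus_local_inverse ab).
by apply: filterS2 near_f (f_prim p) => x fx <-; rewrite -uz.
Qed.

(** The points of [B] other than [u z] form a closed set, avoided near [u z]; the point [u z] itself
    is avoided because the primitive takes the value [c] at [u (z + c)]. *)
Lemma near_not_in_finite (B : set T) z : finite_set B ->
  \forall c \near (0 : plane R), c != 0 -> ~ B (u (z + c)).
Proof.
move=> finB.
have clB : closed (B `\ u z).
  apply: (accessible_finite_set_closed.1 _ _ _).
    exact/hausdorff_accessible/ts_hausdorff.
  exact: finite_setD.
have nB : nbhs (u z) (~` (B `\ u z)).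
  by apply: open_nbhs_nbhs; split; [exact: closed_openC|move=> [_]; exact].
have := near_shift (u_cont nB); have := near_shift (u_prim z).
apply: filterS2 => c prim_c nBc c0 Bc; apply: nBc; split=> //= uE.
move: prim_c; rewrite uE ts_prim0 addrC addKr => /esym/eqP.
by rewrite (negbTE c0).
Qed.

Lemma unique_preimage (A p : M) :
  (forall t, ~ branch_points f t -> f @^-1` [set t] #= `I_d) ->
  finite_set (branch_points f) -> (ts_order A).+1 = d -> f p = f A -> p = A.
Proof.
move=> deg fin_branch ordA fpA; apply: contrapT => /eqP pA.
have [z uz] := u_surj (f A).
have uz' : u z = f p by rewrite fpA.
have := @ts_hausdorff _ M; rewrite open_hausdorff => /(_ _ _ pA).
move=> [[Up UA] /= [/set_mem pUp /set_mem AUA] [oUp oUA /eqP disj]].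
have nA : nbhs A (UA `&` [set x | f x = u (z + ts_prim A x)]).
  by apply: filterI (translation_map_local uz); exact: open_nbhs_nbhs.
have np : nbhs p (Up `&` [set x | f x = u (z + ts_prim p x)]).
  by apply: filterI (translation_map_local uz'); exact: open_nbhs_nbhs.
(* One small [c] serves three purposes: [u (z + c)] is not a branch point, and it has a preimage
   [x ord0] near [p] and [ts_order A + 1 = d] preimages [y i] near [A]. *)
have [c [nb [x [_ /(_ ord0)[[Upx fx] primx]]] [y [y_inj yP]]]] :=
  dnbhs0_pick3 (near_not_in_finite z fin_branch)
    (prim_preimages np) (prim_preimages nA).
have xy i : x ord0 <> y i.
  move=> xyi; have [[UAy _] _] := yP i.
  have : (Up `&` UA) (y i) by split; rewrite // -xyi.
  by rewrite disj.
pose Y o := if o is Some i then y i else x ord0.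
have : (#|{: option 'I_(ts_order A).+1}| <= d)%N.
  apply: (card_fiber_bound (y := Y) (deg _ nb)).
  - move=> [i|] [j|] //=; [by move=> /y_inj->|by move=> /esym/xy|by move=> /xy].
  - case=> [i|] /=; last by rewrite fx primx.
    by have [[_ fy] primy] := yP i; rewrite fy primy.
by rewrite card_option card_ord -ordA ltnn.
Qed.

Variables (P : set (plane R)) (q : plane R -> M).
Hypothesis P_convex : forall (x y : plane R) (t : R), P x -> P y ->
  0 <= t <= 1 -> P (x + t%:C * (y - x)).
Hypothesis q_cont : {within P, continuous q}.
Hypothesis q_prim : forall x, P x ->
  \forall y \near x, P y -> ts_prim (q x) (q y) = y - x.

Lemma develop_local x z : P x -> u z = f (q x) ->
  \forall y \near x, P y -> f (q y) = u (z + (y - x)).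
Proof.
move=> Px uz.
have near_f : nbhs x [set y | P y -> f (q y) = u (z + ts_prim (q x) (q y))].
  apply: (within_continuous_near
    (V := [set y | f y = u (z + ts_prim (q x) y)]) q_cont Px).
  exact: translation_map_local.
by apply: filterS2 near_f (q_prim Px) => y /= fq prim Py; rewrite fq// prim.
Qed.

(** The segment from [x] to [y] stays in [P], and the set of parameters where the formula holds
    contains 0 and is locally constant. *)
Lemma develop x y z : P x -> P y -> u z = f (q x) ->
  f (q y) = u (z + (y - x)).
Proof.
move=> Px Py uz.
pose g t : plane R := x + t%:C * (y - x).
have P_g t : `[0, 1]%classic t -> P (g t).
  by rewrite /= in_itv /= => ht; exact: P_convex.
pose S : set R := [set t | f (q (g t)) = u (z + t%:C * (y - x))].
suff : S 1 by rewrite /S /g /= !mul1r addrC subrK.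
apply: (@connected_locally_constant R `[0, 1]%classic S 0 1).
- exact: segment_connected.
- move=> t /P_g Pgt; have [z' uz'] := u_surj (f (q (g t))).
  have : \forall s \near t, P (g s) -> f (q (g s)) = u (z' + (g s - g t)).
    apply: (continuous_near (V := [set w | P w -> f (q w) = u (z' + (w - g t))])
      (@line_continuous R x (y - x) t)).
    exact: develop_local.
  apply: filterS => s h /P_g/h; rewrite /S /mkset => ->; rewrite -uz'.
  (* At both parameters the formula says that [z'] and [z + t%:C * (y - x)] differ by a lattice
     vector. *)
  have -> : g s - g t = (s%:C - t%:C) * (y - x) by rewrite /g; ring.
  by split=> /u_lattice [m [n mn]]; apply/u_lattice; exists m, n;
    rewrite -mn; ring.
- by rewrite /= in_itv /= lexx ler01.
- by rewrite /= in_itv /= lexx ler01.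
- by rewrite /S /g /= !mul0r !addr0 uz.
Qed.

End Cover.

(** * Compactness of the polygon, and the fibres of [q] in a given direction *)

Lemma polygon_compact (R : realType) (n : nat) (v : 'I_n -> R[i]) :
  compact (polygon v).
Proof.
(* The polygon is the image of the standard simplex under barycentric combination. *)
pose simplex : set 'rV[R]_n :=
  [set l : 'rV[R]_n | forall i, `[0, 1]%classic (l ord0 i)] `&`
  (fun l : 'rV[R]_n => \sum_i l ord0 i) @^-1` [set 1].
have cs : compact simplex.
  apply: compact_closedI.
    exact: (@rV_compact R n (fun=> `[0, 1]%classic)
      (fun=> @segment_compact R 0 1)).
  apply: preimage_closed; last first.
    exact: (accessible_closed_set1 (hausdorff_accessible (@Rhausdorff R))).
  move=> l _; apply: continuous_big; first exact: add_continuous.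
  by move=> i _; exact: coord_continuous.
pose comb (l : 'rV[R]_n) : plane R := \sum_i (l ord0 i)%:C * v i.
have -> : polygon v = comb @` simplex.
  apply/seteqP; split=> z.
    move=> [l [l0 l1 ->]]; exists (\row_i l i); last first.
      by apply: eq_bigr => i _; rewrite mxE.
    split=> [i|]; last by rewrite -l1; apply: eq_bigr => i _; rewrite mxE.
    rewrite mxE /= in_itv /= l0 /= -l1 (bigD1 i)//= lerDl.
    exact: sumr_ge0.
  move=> [l [l01 l1] <-]; exists (l ord0); split=> // i.
  by have := l01 i; rewrite /= in_itv /= => /andP[].
apply: continuous_compact cs; apply: continuous_subspaceT.
apply: continuous_big; first exact: add_continuous.
move=> i _ l; apply: (@continuous_comp _ _ _ (fun l : 'rV[R]_n => l ord0 i)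
  (fun t : R => t%:C * v i : plane R)); first exact: coord_continuous.
by apply: cvgM; [exact: real_complex_continuous|exact: cvg_cst].
Qed.

Section Sectors.
Variables (R : realType) (M : translation_surface R).
Variables (P : set (plane R)) (q : plane R -> M).
Hypotheses (P_compact : compact P) (q_cont : {within P, continuous q}).
Hypothesis q_surj : q @` P = [set: M].
Hypothesis q_prim : forall x, P x ->
  \forall y \near x, P y -> ts_prim (q x) (q y) = y - x.

(** This expresses the cone angle at [p] without angles: the direction [w] occurs at
    [ts_order p + 1] distinct points of the fibre. Each solution near [p] of [ts_prim p = e w] lifts
    to the polygon, and the lift is a fibre point moved by [e w]. *)
Lemma fiber_sectors (p : M) (w : plane R) : w != 0 ->
  exists x : 'I_(ts_order p).+1 -> plane R, injective x /\
    forall i, [/\ P (x i), q (x i) = p &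
      exists2 e : R, 0 < e & P (x i + e%:C * w)].
Proof.
move=> w0.
(* An open set containing the fibre of [p], near each point of which the primitive is a translation;
   by compactness it contains all lifts of points close to [p]. *)
pose N := \bigcup_(x in P `&` q @^-1` [set p])
  [set y | P y -> ts_prim (q x) (q y) = y - x]°.
have oN : open N by apply: bigcup_open => x _; exact: open_interior.
have nU : \forall x \near p, forall y, P y -> q y = x -> N y.
  apply: compact_fiber_near => //; first exact: ts_hausdorff.
  move=> y Py qy; exists y; first by [].
  by have := q_prim Py; rewrite -nbhs_nearE => /nbhs_interior/nbhs_singleton.
have [e e0 h] := near0_ray w (prim_preimages nU).
have c0 : e%:C * w != 0.
  by rewrite mulf_neq0// eq_complex /= eqxx andbT gt_eqF.
have [x [x_inj xP]] := h c0.
have /choice[y yP] : forall i, exists y : plane R,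
    [/\ P y, q y = p, P (y + e%:C * w) & q (y + e%:C * w) = x i].
  move=> i; have [xU prim_x] := xP i.
  have [y Py qy] : (q @` P) (x i) by rewrite q_surj.
  have [y' [Py' qy'] /interior_subset/(_ Py)] := xU y Py qy.
  rewrite qy' qy prim_x => yE; exists y'.
  by rewrite yE addrC subrK.
exists y; split=> [i j yij|i].
  have [_ _ _ xi] := yP i; have [_ _ _ xj] := yP j.
  by apply: x_inj; rewrite -xi -xj yij.
by have [? ? ? _] := yP i; split=> //; exists e.
Qed.

End Sectors.

(** * Polygon points over a zero, and the midpoint contradiction *)

Section Presentation.
Variables (R : realType) (M : translation_surface R).
Variables (n : nat) (v : 'I_n -> R[i]) (s : 'I_n -> 'I_n) (q : plane R -> M).
Hypotheses (convex_v : strictly_convex v) (pairing : edge_pairing v s).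
Hypothesis q_cont : {within polygon v, continuous q}.
Hypothesis q_surj : q @` polygon v = [set: M].
Hypothesis q_glue : forall x y, polygon v x -> polygon v y ->
  (q x = q y <-> Relation_Operators.clos_refl_sym_trans _ (Defs.glue v s) x y).
Hypothesis q_prim : forall x, polygon v x ->
  \forall y \near x, polygon v y -> ts_prim (q x) (q y) = y - x.
Variable A : M.
Hypothesis A_zero : (0 < ts_order A)%N.

Let sectors := fiber_sectors (@polygon_compact R n v) q_cont q_surj q_prim.

(** At a zero every direction occurs at two or more fibre points. The class of an interior point is
    a singleton, and for a point inside an edge some direction is available at only one of its two
    representatives. *)
Lemma fiber_vertex x : polygon v x -> q x = A -> exists i, x = v i.
Proof.
move=> Px qx; apply: contrapT => nv.
have {}nv i : x <> v i by move=> xi; apply: nv; exists i.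
have neq : ord0 != ord_max :> 'I_(ts_order A).+1.
  by rewrite -val_eqE /= eq_sym -lt0n.
have class y : polygon v y -> q y = A ->
    Relation_Operators.clos_refl_sym_trans _ (Defs.glue v s) x y.
  by move=> Py qy; apply/q_glue => //; rewrite qx qy.
have [[i xi]|nedge] := pselect (exists i, edge v i x); last first.
  have [y [y_inj yP]] := sectors A (oner_neq0 _).
  have yx j : y j = x.
    have [Py qy _] := yP j.
    apply: (interior_class pairing) (class _ Py qy) => i xi.
    by apply: nedge; exists i.
  by move/eqP: neq; apply; apply: y_inj; rewrite !yx.
have turn : 0 < cross (edge_vector v i) (edge_vector v (ordS i)).
  by case: convex_v.
(* This direction leaves the polygon across the edge [i], so it rules out [x] and leaves only the
   translate of [x]. *)
have w0 : - edge_vector v (ordS i) != 0.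
  by rewrite oppr_eq0 edge_vector_neq0.
have [y [y_inj yP]] := sectors A w0.
have yx j : y j = x + (v (ordS (s i)) - v i).
  have [Py qy [e e0 Pe]] := yP j.
  have [yjx|//] := edge_interior_class convex_v pairing xi nv (class _ Py qy).
  have := polygon_left convex_v i Pe.
  rewrite yjx addrAC crossDr edge_line// add0r crossZr crossNr.
  by rewrite mulrN oppr_ge0 pmulr_rle0// leNgt turn.
by move/eqP: neq; apply; apply: y_inj; rewrite !yx.
Qed.

Lemma fiber_vertices (w : plane R) : w != 0 ->
  exists k : 'I_(ts_order A).+1 -> 'I_n, injective k /\
    forall i, q (v (k i)) = A /\
      exists2 e : R, 0 < e & polygon v (v (k i) + e%:C * w).
Proof.
move=> w0; have [x [x_inj xP]] := sectors A w0.
have /choice[k kP] : forall i, exists k, x i = v k.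
  by move=> i; have [Px qx _] := xP i; exact: fiber_vertex.
exists k; split=> [i j kij|i]; first by apply: x_inj; rewrite !kP kij.
by rewrite -kP; have [_ qx e] := xP i.
Qed.

(* The corners at [A] have angles less than [pi] and fill [ts_order A + 1] full
   turns; the direction [w] and its opposite both avoid the corner at [v i0],
   and no corner contains both. *)
Lemma many_vertices :
  exists Y : option ('I_(ts_order A).+1 + 'I_(ts_order A).+1) -> 'I_n,
    injective Y /\ forall o, q (v (Y o)) = A.
Proof.
have [k0 [_ /(_ ord0)[qi0 _]]] := fiber_vertices (oner_neq0 _).
set i0 := k0 ord0 in qi0.
pose p0 := ord_pred i0.
(* The diagonal from the predecessor of [v i0] to its successor: [w] points strictly to the right of
   the edge [i0], and [- w] strictly to the right of [p0]. *)
pose w := edge_vector v i0 + edge_vector v p0.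
have turn := cross_pred_gt0 convex_v i0.
have cw : cross (edge_vector v i0) w < 0.
  by rewrite /w crossDr crosszz add0r crossC oppr_lt0.
have cpw : 0 < cross (edge_vector v p0) w.
  by rewrite /w crossDr crosszz addr0.
have w0 : w != 0 by apply: contraTneq cw => ->; rewrite crossr0 ltxx.
have nw0 : - w != 0 by rewrite oppr_eq0.
have [k [k_inj kP]] := fiber_vertices w0.
have [l [l_inj lP]] := fiber_vertices nw0.
have k_i0 j : k j <> i0.
  move=> ki0; have [_ [e e0]] := kP j.
  rewrite ki0 => /(polygon_left convex_v i0).
  by rewrite (addrC (v i0)) addrK crossZr pmulr_rge0// leNgt cw.
have l_i0 j : l j <> i0.
  move=> li0; have [_ [e e0]] := lP j.
  rewrite li0 => /(polygon_left_pred convex_v i0).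
  rewrite (addrC (v i0)) addrK crossZr pmulr_rge0// crossNr oppr_ge0.
  by rewrite leNgt cpw.
have k_l j j' : k j <> l j'.
  move=> kl; have [_ [e e0 Pe]] := kP j; have [_ [e' e0']] := lP j'.
  rewrite -kl mulrN => Pe'.
  by move/eqP: w0; apply; exact: (vertex_extreme convex_v e0 e0' Pe Pe').
exists (fun o => match o with
  | None => i0 | Some (inl j) => k j | Some (inr j) => l j end).
split; last first.
  by move=> [[j|j]|] //; [have [] := kP j|have [] := lP j].
move=> [[j|j]|] [[j'|j']|] //.
- by move/k_inj->.
- by move/k_l.
- by move/k_i0.
- by move/esym/k_l.
- by move/l_inj->.
- by move/l_i0.
- by move/esym/k_i0.
- by move/esym/l_i0.
Qed.

(* Two of at least five points of a plane lattice are congruent modulo twice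
   the lattice, so that their midpoint is again in the lattice. *)
Lemma no_single_fiber (T : translation_surface R) (f : M -> T) :
  is_torus T -> translation_map f -> ~ (forall p, f p = f A -> p = A).
Proof.
move=> [a [b [ab [u [u_cont u_surj u_lattice u_prim]]]]] f_transl fiberA.
have [Y [Y_inj YA]] := many_vertices.
have P_vertex := polygon_vertex v.
have dev := develop ab u_cont u_surj u_lattice u_prim f_transl
  (@polygon_convex R n v) q_cont q_prim.
have [z uz] := u_surj (f A).
have uzq o : u z = f (q (v (Y o))) by rewrite YA.
have /choice[m /choice[m' mE]] : forall o, exists m m' : int,
    v (Y o) - v (Y None) = a *~ m + b *~ m'.
  move=> o; have := dev _ _ _ (P_vertex (Y None)) (P_vertex (Y o)) (uzq None).
  rewrite -uzq => /u_lattice[m [m' mE]]; exists m, m'.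
  by rewrite -mE [RHS]addrC addKr.
(* There are four parity classes, and [2 * (ts_order A + 1) + 1] is at least 5. *)
pose par o := ((m o %% 2)%Z == 0, (m' o %% 2)%Z == 0).
have /injectivePn[c [c' cc' /pair_equal_spec[par1 par2]]] : ~~ injectiveb par.
  apply/injectiveP => /leq_card.
  rewrite card_option card_sum !card_ord card_prod card_bool.
  by rewrite leqNgt ltnS => /negP; apply; rewrite addSn addnS !ltnS; lia.
have half_diff (r r' : int) : ((r %% 2)%Z == 0) = ((r' %% 2)%Z == 0) ->
    exists k : int, r - r' = k + k.
  by move=> rr'; exists ((r %/ 2)%Z - (r' %/ 2)%Z); lia.
have [k kE] := half_diff _ _ par1.
have [k' kE'] := half_diff _ _ par2.
pose x := v (Y c); pose y := v (Y c').
pose h : R[i] := a *~ k + b *~ k'.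
have xy : x - y = h + h.
  have -> : x - y = (x - v (Y None)) - (y - v (Y None)).
    by rewrite opprB addrA subrK.
  rewrite /x /y !mE opprD addrACA -!mulrzBr kE kE' !mulrzDr.
  by rewrite addrACA.
have half_double (w : R[i]) : (2^-1)%:C * (w + w) = w.
  rewrite mulrDr -mulrDl -rmorphD /=.
  by have -> : 2^-1 + 2^-1 = 1 :> R; [lra|rewrite rmorph1 mul1r].
have midE : y + (2^-1)%:C * (x - y) = y + h by rewrite xy half_double.
have Pmid : polygon v (y + h).
  by rewrite -midE; apply: polygon_convex; [exact: P_vertex..|lra].
(* Since [h] is in the lattice, the midpoint lies over [f A], so it maps to [A] and must be a
   vertex. *)
have [i iE] : exists i, y + h = v i.
  apply: fiber_vertex => //; apply: fiberA.
  rewrite (dev _ _ _ (P_vertex (Y c')) Pmid (uzq c')) -uz.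
  by apply/esym/u_lattice; exists k, k'; rewrite [LHS]addrC addKr addrC addKr.
have h0 : h = 0.
  (* The points [v i + h] and [v i - h] are [x] and [y]. *)
  apply: (vertex_extreme convex_v (i := i) (ltr01 : 0 < 1 :> R) ltr01).
    by rewrite rmorph1 mul1r -iE -addrA -xy addrC subrK; exact: P_vertex.
  by rewrite rmorph1 mul1r -iE addrK; exact: P_vertex.
case/eqP: cc'; apply: Y_inj; case: convex_v => _ v_inj _ _; apply: v_inj.
by apply/subr0_eq; rewrite -/x -/y xy h0 addr0.
Qed.

End Presentation.

Theorem proposition42 (R : realType) (g : nat) (hg : (2 <= g)%N) :
  exists d0 : nat, (g <= d0)%N /\
    forall d : nat, (g <= d)%N -> (d <= d0)%N ->
      forall M : translation_surface R,
        hurwitz_locus d g M -> ~ has_strictly_convex_presentation M.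
Proof.
exists g; split=> // d gd dg M.
have {gd dg} -> : d = g by apply/eqP; rewrite eqn_leq dg.
move=> [[A [B [[_ _ ordA _ _] _]]] [T torusT [f [f_transl deg] branch]]].
move=> [n [v [s [convex_v [pairing [q [q_cont q_surj q_glue q_prim]]]]]]].
have A_zero : (0 < ts_order A)%N by rewrite ordA -subn1 subn_gt0.
apply: (no_single_fiber convex_v pairing q_cont q_surj q_glue q_prim A_zero
  torusT f_transl) => p.
have [a [b [ab [u [u_cont u_surj u_lattice u_prim]]]]] := torusT.
apply: (unique_preimage ab u_cont u_surj u_lattice u_prim f_transl deg).
  by apply/finite_setP; exists 2.
(* Total ramification: the local degree at [A] is [g.-1.+1], which is the degree [g] of the
   cover. *)
by rewrite ordA prednK// ltnW.
Qed.
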